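(* $\mathsf{GLP}$ is strongly complete for poly-provability $\mathsf{GLP}$-models: for every set $\Gamma\subseteq\mathcal L_\omega$ and every $A\in\mathcal L_\omega$, if for every poly-provability $\mathsf{GLP}$-model $\mathcal P$ and every world $w$ of $\mathcal P$, $\mathcal P,w\Vdash B$ for all $B\in\Gamma$ implies $\mathcal P,w\Vdash A$, then $A$ is derivable from $\Gamma$ together with the axioms of $\mathsf{GLP}$ using modus ponens.
   Context: Language $\mathcal L_\omega$: formulas built from atomic propositions and $\bot$ using $\to$ and unary modal operators $[n]$ for each $n\in\mathbb N$. Purely modal: Boolean combination of formulas $[n]B$. $\mathsf{GLP}$ has modus ponens as only rule and axioms: classical tautologies; $[n](A\to B)\to([n]A\to[n]B)$; $[n]A\to[n][n]A$; $[n]([n]A\to A)\to[n]A$; $[n]A\to[n+1]A$; $\neg[n]A\to[n+1]\neg[n]A$; and $[0]X$ for $X$ any of these axioms. A theory is a pair of a set of axioms and a set of inference rules (finitely many premises, one conclusion); $\mathsf T\vdash A$ means derivability; $\mathsf T\subseteq\mathsf T'$ means every theorem of $\mathsf T$ is a theorem of $\mathsf T'$. A poly-provability pre-model is $\mathcal P=(W,\{\sqsubset_n\}_{n\in\mathbb N},\{L^n_w\}_{n\in\mathbb N,w},V)$ with $W$ nonempty, each $\sqsubset_n$ a binary relation on $W$, $V\subseteq W\times\mathrm{atoms}$, and a theory $L^n_w$ for each $n$ and each $w\in W^{\sqsubset_0}=\{u:\exists v\,(v\sqsubset_0u)\}$. Satisfaction: atoms via $V$, $\bot$ never holds, $\to$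 classical, $\mathcal P,w\Vdash[n]B$ iff $L^n_u\vdash B$ for all $u$ with $w\sqsubset_n u$. $\mathcal P,w\Vdash^+_0A$ iff $\mathcal P,u\Vdash A$ for every $u$ reachable from $w$ by a finite (possibly empty) chain of $\sqsubset_0$-steps. $\mathcal P$ is a poly-provability model if for all $n$ and $w\in W^{\sqsubset_0}$: $L^n_w$ is classical (all classical tautologies derivable, modus ponens a rule), and modal completeness holds: for purely modal $A$, $\mathcal P,w\Vdash^+_0A$ implies $L^0_w\vdash A$. It is a poly-provability $\mathsf{GLP}$-model if moreover: each $L^n_w$ has the rule ''from $A$ infer $[n]A$'' and the rule ''from $[n]A\to A$ infer $A$''; ascending: $\sqsubset_{n+1}\subseteq\sqsubset_n$ and $L^n_w\subseteq L^{n+1}_w$; $\Pi$-completeness: if $u\sqsubset_{n+1}w$ and $\mathcal P,u\Vdash\neg[n]A$ then $L^{n+1}_w\vdash\neg[n]A$. *)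

(* Defs.v *)
From Stdlib Require Import List Relation_Operators.
From mathcomp Require Import all_boot.
From mathcomp Require Import classical_sets.

Set Implicit Arguments.
Unset Strict Implicit.
Unset Printing Implicit Defensive.

Local Open Scope classical_set_scope.

Inductive form (atom : Type) : Type :=
| Var of atom
| Bot
| Imp of form atom & form atom
| Box of nat & form atom.

Arguments Bot {atom}.

Definition Neg (atom : Type) (A : form atom) : form atom := Imp A Bot.

Inductive purely_modal (atom : Type) : form atom -> Prop :=
| PM_Bot : purely_modal Bot
| PM_Box n B : purely_modal (Box n B)
| PM_Imp A B : purely_modal A -> purely_modal B -> purely_modal (Imp A B).

(* Atoms and boxed formulas are the propositional letters; [v] is only
   consulted on those. *)
Fixpoint beval (atom : Type) (v : form atom -> bool) (A : form atom) : bool :=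
  match A with
  | Bot => false
  | Imp B C => beval v B ==> beval v C
  | Var _ | Box _ _ => v A
  end.

Definition tautology (atom : Type) (A : form atom) : Prop :=
  forall v : form atom -> bool, beval v A.

(* An inference rule is given by its instances (premises, conclusion);
   [rules] is the set of all instances of all rules of the theory. *)
Record theory (atom : Type) := Theory {
  axioms : set (form atom);
  rules : set (seq (form atom) * form atom) }.

Inductive derivable (atom : Type) (T : theory atom) : form atom -> Prop :=
| Der_axiom A : axioms T A -> derivable T A
| Der_rule (ps : seq (form atom)) A :
    rules T (ps, A) -> (forall B, In B ps -> derivable T B) -> derivable T A.

Definition subtheory (atom : Type) (T T' : theory atom) : Prop :=
  derivable T `<=` derivable T'.

Definition modus_ponens (atom : Type) : set (seq (form atom) * form atom) :=
  [set r | exists A B, r = ([:: Imp A B; A], B)].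

Definition necessitation (atom : Type) (n : nat) :
    set (seq (form atom) * form atom) :=
  [set r | exists A, r = ([:: A], Box n A)].

Definition loeb_rule (atom : Type) (n : nat) :
    set (seq (form atom) * form atom) :=
  [set r | exists A, r = ([:: Imp (Box n A) A], A)].

Arguments modus_ponens {atom}.
Arguments necessitation {atom}.
Arguments loeb_rule {atom}.

Definition classical (atom : Type) (T : theory atom) : Prop :=
  (forall A, tautology A -> derivable T A) /\ modus_ponens `<=` rules T.

Inductive glp_base_axiom (atom : Type) : form atom -> Prop :=
| GLP_taut A : tautology A -> glp_base_axiom A
| GLP_K n A B :
    glp_base_axiom (Imp (Box n (Imp A B)) (Imp (Box n A) (Box n B)))
| GLP_4 n A : glp_base_axiom (Imp (Box n A) (Box n (Box n A)))
| GLP_Loeb n A : glp_base_axiom (Imp (Box n (Imp (Box n A) A)) (Box n A))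
| GLP_mono n A : glp_base_axiom (Imp (Box n A) (Box n.+1 A))
| GLP_Pi n A :
    glp_base_axiom (Imp (Neg (Box n A)) (Box n.+1 (Neg (Box n A)))).

Inductive glp_axiom (atom : Type) : form atom -> Prop :=
| GLP_base A : glp_base_axiom A -> glp_axiom A
| GLP_nec A : glp_base_axiom A -> glp_axiom (Box 0 A).

Definition GLP (atom : Type) : theory atom :=
  Theory (@glp_axiom atom) modus_ponens.

Definition add_axioms (atom : Type) (T : theory atom) (G : set (form atom)) :
    theory atom :=
  Theory (axioms T `|` G) (rules T).

(* [thy n w] is meaningful only for [w] having an [acc 0]-predecessor; it is a
   total function because [sat] mentions [thy n u] for [acc n w u], and in a
   mere pre-model [acc n] need not be included in [acc 0]. No model condition
   below constrains the other values, and in a GLP-model they are never used. *)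
Record premodel (atom : Type) := Premodel {
  world : Type;
  world_inhabited : inhabited world;
  acc : nat -> world -> world -> Prop;
  thy : nat -> world -> theory atom;
  valuation : world -> atom -> Prop }.

Definition has_pred (atom : Type) (P : premodel atom) : set (world P) :=
  [set w | exists v, acc 0 v w].

Arguments has_pred {atom} P _.

Fixpoint sat (atom : Type) (P : premodel atom) (w : world P) (A : form atom) :
    Prop :=
  match A with
  | Var p => valuation w p
  | Bot => False
  | Imp B C => sat w B -> sat w C
  | Box n B => forall u, acc n w u -> derivable (thy n u) B
  end.

Definition sat_plus0 (atom : Type) (P : premodel atom) (w : world P)
    (A : form atom) : Prop :=
  forall u, clos_refl_trans (world P) (acc 0) w u -> sat u A.

Record is_pp_model (atom : Type) (P : premodel atom) : Prop := {
  pp_classical : forall n (w : world P), has_pred P w -> classical (thy n w);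
  pp_modal_complete : forall (w : world P) A, has_pred P w ->
    purely_modal A -> sat_plus0 w A -> derivable (thy 0 w) A }.

Record is_pp_GLP_model (atom : Type) (P : premodel atom) : Prop := {
  glp_model : is_pp_model P;
  glp_necessitation : forall n (w : world P), has_pred P w ->
    necessitation n `<=` rules (thy n w);
  glp_loeb : forall n (w : world P), has_pred P w ->
    loeb_rule n `<=` rules (thy n w);
  glp_acc_ascending : forall n (w u : world P), acc n.+1 w u -> acc n w u;
  glp_thy_ascending : forall n (w : world P), has_pred P w ->
    subtheory (thy n w) (thy n.+1 w);
  glp_Pi_complete : forall n (u w : world P) A, acc n.+1 u w ->
    sat u (Neg (Box n A)) -> derivable (thy n.+1 w) (Neg (Box n A)) }.

(* Main.v *)
Require Import Defs.
From mathcomp Require Import all_boot.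
From mathcomp Require Import boolp classical_sets.

(** Canonical model. Call a set of formulas a GLP-world if it is maximal
    consistent over [GLP]. The worlds of the model are pairs [(X, Y)] of
    GLP-worlds: [Y] is the set of formulas true at [(X, Y)], and the theory
    [L^n] at [(X, Y)] has as theorems exactly the [B] with [[n]B] in [X]. For
    every [n], the successors of [(X, Y)] are all pairs [(Y, Z)], with [Z]
    arbitrary; the truth lemma is then immediate, and the GLP axioms in [X]
    yield the closure conditions on the theories. Since [Z] is arbitrary, a
    formula true at all worlds reachable from [(X, Y)] belongs to every
    GLP-world, hence is a theorem of [GLP], hence its [[0]]-necessitation lies
    in [X]: this is modal completeness. *)

Set Implicit Arguments.
Unset Strict Implicit.
Unset Printing Implicit Defensive.

Local Open Scope classical_set_scope.

(** * Derivability by modus ponens and Lindenbaum's lemma *)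

Section Hilbert.
Variable atom : Type.
Implicit Types (A B C : form atom) (S T G X : set (form atom)).

(** Both [GLP atom] and [add_axioms (GLP atom) Gamma] are convertible to theories of this form. *)
Definition mp_theory S : theory atom := Theory S modus_ponens.

Lemma mp_theory_MP S A B :
  derivable (mp_theory S) (Imp A B) -> derivable (mp_theory S) A ->
  derivable (mp_theory S) B.
Proof.
move=> dAB dA; apply: (@Der_rule _ (mp_theory S) [:: Imp A B; A]).
  by exists A, B.
by move=> C /= [<-|[<-|[]]].
Qed.

Lemma mp_theory_ind S (P : form atom -> Prop) :
  (forall A, S A -> P A) -> (forall A B, P (Imp A B) -> P A -> P B) ->
  forall A, derivable (mp_theory S) A -> P A.
Proof.
move=> PS PMP A; elim=> {A} [A /PS //|ps A [B [C [-> ->]]] _ IH].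
by apply: (PMP B); apply: IH => /=; [left|right; left].
Qed.

Lemma mp_theory_sub S T A :
  S `<=` T -> derivable (mp_theory S) A -> derivable (mp_theory T) A.
Proof.
move=> ST; move: A; apply: mp_theory_ind => [B /ST SB|B C].
  exact: Der_axiom.
exact: mp_theory_MP.
Qed.

Lemma deduction S B A : @tautology atom `<=` S ->
  derivable (mp_theory (S `|` [set B])) A -> derivable (mp_theory S) (Imp B A).
Proof.
move=> tS; have taut C : tautology C -> derivable (mp_theory S) C.
  by move=> /tS SC; exact: Der_axiom.
move: A; apply: mp_theory_ind => [C [SC|->]|C D IHD IHC].
- apply: (@mp_theory_MP S C); last exact: Der_axiom.
  by apply: taut => v /=; do 2 case: (beval v _).
- by apply: taut => v /=; case: (beval v _).
- apply: mp_theory_MP IHC; apply: mp_theory_MP IHD.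
  by apply: taut => v /=; do 3 case: (beval v _).
Qed.

(** Two members of a chain lie in the larger one, so modus ponens never needs more than one member.
    The first disjunct covers the empty chain. *)
Lemma derivable_chain S (F : set (set (form atom))) A :
  total_on F subset -> derivable (mp_theory (S `|` \bigcup_(X in F) X)) A ->
  derivable (mp_theory S) A \/
  exists2 X, F X & derivable (mp_theory (S `|` X)) A.
Proof.
move=> totF; move: A.
apply: mp_theory_ind => [A [SA|[X FX XA]]|A B IHAB IHA].
- by left; exact: Der_axiom.
- by right; exists X => //; apply: Der_axiom; right.
have up X Y C : X `<=` Y -> derivable (mp_theory (S `|` X)) C ->
    derivable (mp_theory (S `|` Y)) C.
  by move=> XY; apply: mp_theory_sub; exact: setUS.
have up0 X C : derivable (mp_theory S) C -> derivable (mp_theory (S `|` X)) C.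
  by apply: mp_theory_sub => D; left.
case: IHAB IHA => [dAB|[X FX dAB]] [dA|[Y FY dA]].
- by left; exact: mp_theory_MP dA.
- by right; exists Y => //; apply: mp_theory_MP dA; exact: up0.
- by right; exists X => //; apply: mp_theory_MP dAB _; exact: up0.
- right; case: (totF X Y FX FY) => le.
    by exists Y => //; apply: mp_theory_MP dA; exact: up dAB.
  by exists X => //; apply: mp_theory_MP dAB _; exact: up dA.
Qed.

(** These are the truth clauses of [Bot] and [Imp]; with [B := Bot], exactly one of [A] and [Neg A]
    is in [X]. *)
Definition maximal_consistent X : Prop :=
  ~ X Bot /\ forall A B, X (Imp A B) <-> (X A -> X B).

(** Zorn's lemma gives a maximal [G] with [A] underivable from [S] and [G]; the witness is the set
    of consequences. *)
Lemma lindenbaum S A : @tautology atom `<=` S -> ~ derivable (mp_theory S) A ->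
  exists X, [/\ S `<=` X, maximal_consistent X & ~ X A].
Proof.
move=> tS nSA.
have [F FP totF|G [nGA maxG]] :=
    @Zorn_bigcup _ [set G | ~ derivable (mp_theory (S `|` G)) A].
  by move=> /= /(derivable_chain totF) [//|[X /FP]].
pose T := derivable (mp_theory (S `|` G)).
have tT : @tautology atom `<=` T by move=> B /tS SB; apply: Der_axiom; left.
have MP B C : T (Imp B C) -> T B -> T C by exact: mp_theory_MP.
(* Adding [B] enlarges [G] properly, so by maximality [A] becomes derivable. *)
have refute B : ~ T B -> T (Imp B A).
  move=> nTB; apply: deduction => [C /tS|]; first by left.
  rewrite -setUA; apply: contrapT; apply: maxG; rewrite properEneq; split.
    apply/eqP => eG; apply: nTB; apply: Der_axiom; right.
    by rewrite eG; right.
  by move=> C; left.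
exists T; split=> //; first by move=> B SB; apply: Der_axiom; left.
split=> [TBot|B C].
  by apply: nGA; apply: MP TBot; apply: tT.
split=> [TBC TB|TBC]; first exact: MP TB.
have [TB|/refute TBA] := pselect (T B).
  apply: MP (TBC TB).
  by apply: tT => v /=; do 2 case: (beval v _).
(* [A] would follow from both [B] and [Imp B C], one of which always holds classically. *)
apply: contrapT => /refute TBCA; apply: nGA.
apply: (MP _ _ _ TBA); apply: MP TBCA.
by apply: tT => v /=; do 3 case: (beval v _).
Qed.

End Hilbert.

(** * The canonical model of pairs of GLP-worlds *)

Section CanonicalModel.
Variable atom : Type.
Implicit Types (A B C : form atom) (X Y Z : set (form atom)).

(** Boxed axioms are handled by axiom 4, modus ponens by K. *)
Lemma GLP_box0 A : derivable (GLP atom) A -> derivable (GLP atom) (Box 0 A).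
Proof.
move: A; apply: mp_theory_ind => [B [C bC|C bC]|B C dBC dB].
- by apply: Der_axiom; exact: GLP_nec.
- apply: (@mp_theory_MP _ _ (Box 0 C)); apply: Der_axiom.
    by apply: GLP_base; exact: GLP_4.
  exact: GLP_nec.
- apply: mp_theory_MP dB; apply: mp_theory_MP dBC.
  by apply: Der_axiom; apply: GLP_base; exact: GLP_K.
Qed.

Definition glp_world X : Prop :=
  @glp_axiom atom `<=` X /\ maximal_consistent X.

Lemma glp_world_MP X A B : glp_world X -> X (Imp A B) -> X A -> X B.
Proof. by move=> [_ [_ XI]] /XI. Qed.

Lemma glp_world_base X A B :
  glp_world X -> glp_base_axiom (Imp A B) -> X A -> X B.
Proof. by move=> wX bAB; apply: glp_world_MP => //; apply: wX.1; left. Qed.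

Lemma glp_world_box X n A : glp_world X -> X (Box 0 A) -> X (Box n A).
Proof.
move=> wX X0; elim: n => // n; apply: glp_world_base => //; exact: GLP_mono.
Qed.

Lemma glp_world_theorem X A : glp_world X -> derivable (GLP atom) A -> X A.
Proof.
move=> wX; move: A; apply: mp_theory_ind => [|B C].
  exact: wX.1.
exact: glp_world_MP.
Qed.

(** All intended theorems are already axioms; the rules are listed because a GLP-model must have
    them as rules. *)
Definition canonical_theory n X : theory atom :=
  Theory [set B | X (Box n B)] (modus_ponens `|` necessitation n `|` loeb_rule n).

(** The rules add no theorems: K, 4 and Löb's axiom in [X] absorb modus ponens, necessitation and
    Löb's rule respectively. *)
Lemma derivable_canonical n X B :
  glp_world X -> derivable (canonical_theory n X) B <-> X (Box n B).
Proof.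
move=> wX; split=> [|XB]; last exact: Der_axiom.
elim=> {B} [//|ps B + _].
case=> [[[C [D [-> ->]]]|[C [-> ->]]]|[C [-> ->]]] IH.
- have XC : X (Box n C) by apply: IH; right; left.
  apply: glp_world_MP XC => //.
  have : X (Box n (Imp C D)) by apply: IH; left.
  by apply: glp_world_base => //; exact: GLP_K.
- have : X (Box n C) by apply: IH; left.
  by apply: glp_world_base => //; exact: GLP_4.
- have : X (Box n (Imp (Box n C) C)) by apply: IH; left.
  by apply: glp_world_base => //; exact: GLP_Loeb.
Qed.

Definition canonical_model (X0 : {X | glp_world X}) : premodel atom :=
  {| world := {X | glp_world X} * {X | glp_world X};
     world_inhabited := inhabits (X0, X0);
     acc := fun _ w u => u.1 = w.2;
     thy := fun n w => canonical_theory n (sval w.1);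
     valuation := fun w p => sval w.2 (Var p) |}.

Lemma canonical_truth (X0 : {X | glp_world X})
    (w : world (canonical_model X0)) A :
  sat w A <-> sval w.2 A.
Proof.
case: w => [X [Y wY]]; elim: A => [p||A IHA B IHB|n A _] //=.
- by split=> [//|/wY.2.1].
- by rewrite IHA IHB; symmetry; exact: wY.2.2.
split=> [|YA [U V] /= ->]; last exact/derivable_canonical.
(* Every successor carries the theory given by [Y], so one successor suffices; [X0] fills its second
   component. *)
by move/(_ (exist _ Y wY, X0) erefl)/(derivable_canonical _ _ wY).
Qed.

Lemma canonical_model_GLP (X0 : {X | glp_world X}) :
  is_pp_GLP_model (canonical_model X0).
Proof.
split=> [|n w _ r nr|n w _ r lr|//|n [[X wX] Y] _ A|n [X Y] [_ Z] A /= ->].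
- split=> [n [[X wX] Y] _|[[X wX] [Y wY]] A _ _ satA].
    split=> [A tA|r mr]; last by left; left.
    apply/derivable_canonical => //=; apply: glp_world_box => //.
    by apply: wX.1; apply: GLP_nec; exact: GLP_taut.
  apply/derivable_canonical => //=.
  apply: glp_world_theorem => //; apply: GLP_box0; apply: contrapT => nA.
  have [|Z [axZ mcZ nZA]] := @lindenbaum _ (@glp_axiom atom) A _ nA.
    by move=> B tB; apply: GLP_base; exact: GLP_taut.
  apply: nZA.
  have wZ : glp_world Z by [].
  (* A successor of the given world at which exactly the formulas of [Z] are true, so [A] fails
     there. *)
  pose u : world (canonical_model X0) := (exist _ Y wY, exist _ Z wZ).
  apply: (@canonical_truth X0 u A).1.
  by apply: satA; exact: Relation_Operators.rt_step.
- by left; right.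
- by right.
- move=> /(derivable_canonical _ _ wX) XA.
  apply/derivable_canonical => //; apply: glp_world_base XA => //.
  exact: GLP_mono.
(* The theory at the successor is given by [Y], the set of formulas true at the predecessor, so the
   Pi axiom applies inside [Y]. *)
- case: Y => Y wY satn; apply/derivable_canonical => //=.
  apply: (@glp_world_base Y (Neg (Box n A))) => //; first exact: GLP_Pi.
  apply: (@canonical_truth X0 (X, exist _ Y wY) (Neg (Box n A))).1 => /= YA.
  by apply: satn.
Qed.

End CanonicalModel.

Theorem theorem6p3 (atom : Type) (Gamma : set (form atom)) (A : form atom) :
  (forall P : premodel atom, is_pp_GLP_model P ->
     forall w : world P,
       (forall B : form atom, Gamma B -> sat w B) -> sat w A) ->
  derivable (add_axioms (GLP atom) Gamma) A.
Proof.
move=> consA; apply: contrapT => nA.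
have [|X [subX mcX nXA]] := @lindenbaum _ (@glp_axiom atom `|` Gamma) A _ nA.
  by move=> B tB; left; apply: GLP_base; exact: GLP_taut.
have wX : glp_world X by split=> // B axB; apply: subX; left.
pose X0 := exist _ X wX.
(* The second component makes the formulas of [X] the true ones. *)
pose w : world (canonical_model X0) := (X0, X0).
apply: nXA; apply/(canonical_truth w)/consA; first exact: canonical_model_GLP.
by move=> B GB; apply/canonical_truth/subX; right.
Qed.
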